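(* Let $Y$ be a lattice such that $\operatorname{DM}(Y)$ is infinitely distributive and let $T:Y\to L$ be a lattice homomorphism, where $L$ is an infinitely distributive complete lattice. Define $$\overline T:\operatorname{DM}(Y)\to L,\qquad x\mapsto\bigvee{}^{L}\{T(y): y\in Y,\ y\le x\},$$ where $Y$ is identified with its canonical image in $\operatorname{DM}(Y)$. (i) $\overline T$ is a meet-homomorphism (it preserves binary meets) extending $T$. (ii) If $T$ preserves every join that exists in its domain, then so does $\overline T$.
   Context: A lattice $L$ is infinitely distributive if whenever $\bigvee A$ exists, $x\wedge\bigvee A=\bigvee_{a\in A}(x\wedge a)$ for every $x\in L$, and whenever $\bigwedge A$ exists, $x\vee\bigwedge A=\bigwedge_{a\in A}(x\vee a)$ for every $x\in L$. A lattice is complete if every subset, including the empty set, has a supremum and an infimum. For $A\subseteq Y$, $A^+$ and $A^-$ denote the sets of upper and lower bounds of $A$ in $Y$. The Dedekind–MacNeille completion $\operatorname{DM}(Y)$ is the complete lattice of all $C\subseteq Y$ with $C=C^{+-}$, ordered by inclusion; $Y$ is embedded in it via $y\mapsto\mathord\downarrow y=\{z\in Y: z\le y\}$. Thus for $x\in\operatorname{DM}(Y)$ and $y\in Y$, $y\le x$ means $\mathord\downarrow y\subseteq x$, i.e. $y\in x$. A map preserves every join that exists in its domain if, whenever $S$ is a nonempty subset of its domain with a supremum, the image of $S$ has a supremum in the codomain equal to the image of $\bigvee S$. *)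

(* Defs.v *)
From HB Require Import structures.
From mathcomp Require Import all_boot all_order.
From mathcomp Require Import boolp classical_sets.
Set Implicit Arguments.
Unset Strict Implicit.
Unset Printing Implicit Defensive.
Import Order.TTheory.
Local Open Scope classical_set_scope.
Local Open Scope order_scope.

(* [supremums A s] (resp. [infimums A s]) says that A has a supremum (resp. an
   infimum), equal to s.  In the next two definitions A may be empty. *)
Definition infinitely_distributive d (L : latticeType d) : Prop :=
  (forall (A : set L) (s : L), supremums A s ->
     forall x : L, supremums [set x `&` a | a in A] (x `&` s)) /\
  (forall (A : set L) (i : L), infimums A i ->
     forall x : L, infimums [set x `|` a | a in A] (x `|` i)).

Definition complete_lattice d (L : latticeType d) : Prop :=
  forall A : set L, (supremums A !=set0) /\ (infimums A !=set0).

Definition csup d (L : latticeType d) (hL : complete_lattice L) (A : set L) : L :=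
  projT1 (cid (hL A).1).

Lemma csupP d (L : latticeType d) (hL : complete_lattice L) (A : set L) :
  supremums A (csup hL A).
Proof. exact: (projT2 (cid (hL A).1)). Qed.

Definition preserves_existing_joins d d' (X : porderType d) (Z : porderType d')
    (f : X -> Z) : Prop :=
  forall (S : set X) (s : X), S !=set0 -> supremums S s ->
    supremums (f @` S) (f s).

Definition dm_closed d (Y : porderType d) (C : set Y) : bool :=
  `[< C = lbound (ubound C) >].

Record DM d (Y : porderType d) := MkDM {
  dm_set : set Y;
  dm_setP : dm_closed dm_set
}.

Fact dm_display : Order.disp_t. Proof. exact: Order.Disp tt tt. Qed.

Section DMLattice.
Variables (d : Order.disp_t) (Y : porderType d).
Implicit Types (A B : set Y) (x y z : DM Y).

HB.instance Definition _ := [isSub for @dm_set d Y].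
HB.instance Definition _ := [Choice of DM Y by <:].
HB.instance Definition _ :=
  Order.SubChoice_isSubPOrder.Build set_display (set Y) (@dm_closed d Y)
    dm_display (DM Y).

Lemma dm_leE x y : (x <= y) = `[< (dm_set x `<=` dm_set y)%classic >].
Proof. by []. Qed.

Lemma dm_eq x : dm_set x = lbound (ubound (dm_set x)).
Proof. exact: asboolW (dm_setP x). Qed.

Lemma sub_dm A : (A `<=` lbound (ubound A))%classic.
Proof. by move=> a Aa b; exact. Qed.

Lemma dm_closureS A B : (A `<=` B)%classic ->
  (lbound (ubound A) `<=` lbound (ubound B))%classic.
Proof. by move=> AB a Aa b Bb; apply: Aa => c /AB; exact: Bb. Qed.

Lemma dm_closure_closed A : dm_closed (lbound (ubound A)).
Proof.
apply/asboolP; rewrite eqEsubset; split; first exact: sub_dm.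
by move=> a Aa b Ab; apply: Aa => c; exact.
Qed.

Definition dm_closure A : DM Y := MkDM (dm_closure_closed A).

Lemma dm_closure_le A x : (dm_closure A <= x) = `[< (A `<=` dm_set x)%classic >].
Proof.
rewrite dm_leE; apply: asbool_equiv_eq; split=> /= Ax.
  exact: subset_trans (@sub_dm A) Ax.
by rewrite dm_eq; exact: dm_closureS.
Qed.

Lemma dm_bigcap_closed (F : set (DM Y)) :
  dm_closed [set y | forall x, F x -> dm_set x y].
Proof.
apply/asboolP; rewrite eqEsubset; split; first exact: sub_dm.
move=> a Aa x Fx; rewrite dm_eq; apply: dm_closureS Aa.
by move=> b; exact.
Qed.

Lemma dm_meet_closed x y : dm_closed (dm_set x `&` dm_set y)%classic.
Proof.
apply/asboolP; rewrite eqEsubset; split; first exact: sub_dm.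
by move=> a Aa; split; rewrite dm_eq; apply: dm_closureS Aa => b [].
Qed.

Definition dm_meet x y : DM Y := MkDM (dm_meet_closed x y).
Definition dm_join x y : DM Y := dm_closure (dm_set x `|` dm_set y)%classic.

Fact dm_meetP x y z : (x <= dm_meet y z) = (x <= y) && (x <= z).
Proof. by rewrite !dm_leE /= -asbool_and; apply: asbool_equiv_eq; rewrite subsetI. Qed.

Fact dm_joinP x y z : (dm_join x y <= z) = (x <= z) && (y <= z).
Proof.
by rewrite dm_closure_le !dm_leE -asbool_and; apply: asbool_equiv_eq; rewrite subUset.
Qed.

HB.instance Definition _ :=
  Order.POrder_MeetJoin_isLattice.Build dm_display (DM Y) dm_meetP dm_joinP.

Lemma dm_embed_closed (y : Y) : dm_closed [set z | z <= y].
Proof.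
apply/asboolP; rewrite eqEsubset; split; first exact: sub_dm.
by move=> a; apply=> b.
Qed.

Definition dm_embed (y : Y) : DM Y := MkDM (dm_embed_closed y).

Lemma dm_embed_le (y : Y) x : dm_embed y <= x <-> dm_set x y.
Proof.
rewrite dm_leE; split=> [/asboolP|xy]; first by apply=> /=.
apply/asboolP => z /= zy; rewrite dm_eq => b xb.
exact: le_trans zy (xb _ xy).
Qed.

End DMLattice.

Lemma DM_complete d (Y : porderType d) : complete_lattice (DM Y).
Proof.
move=> F; split.
  exists (dm_closure [set y | exists2 x, F x & dm_set x y]); split.
    by move=> x Fx; rewrite dm_leE; apply/asboolP => y xy; apply: sub_dm; exists x.
  move=> u Fu; rewrite dm_closure_le; apply/asboolP => y [x Fx]; move: y.
  by apply/asboolP; rewrite -dm_leE; exact: Fu.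
exists (MkDM (dm_bigcap_closed F)); split.
  by move=> x Fx; rewrite dm_leE; apply/asboolP => y; exact.
move=> l Fl; rewrite dm_leE; apply/asboolP => y ly x Fx.
by have := Fl _ Fx; rewrite dm_leE => /asboolP; exact.
Qed.

Definition dm_ext d d' (Y : porderType d) (L : latticeType d')
    (hL : complete_lattice L) (T : Y -> L) (x : DM Y) : L :=
  csup hL [set T y | y in [set y | dm_embed y <= x]].

(* Main.v *)
Require Import Defs.
From mathcomp Require Import all_boot all_order.
From mathcomp Require Import boolp classical_sets.
Set Implicit Arguments.
Unset Strict Implicit.
Unset Printing Implicit Defensive.
Import Order.TTheory.
Local Open Scope classical_set_scope.
Local Open Scope order_scope.

(** The extension of [T] sends a cut [x] to the supremum of [T] over its points.
    Preservation of meets is then a computation in [L]: by distributivity, the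
    meet of two such suprema is the supremum of the elements
    [T a `&` T b = T (a `&` b)] with [a] in [x] and [b] in [z], and [a `&` b]
    is a point of both cuts.

    For joins, let [s] be the supremum of a family [S] of cuts.  Since the
    extension is monotone, it is enough to bound [T y] for every point [y] of
    [s] by every upper bound of the values on [S].  Although [y] need not belong
    to any member of [S], distributivity of the completion gives
    [dm_embed y = \/_(c in S) (dm_embed y `&` c)], and this join of cuts
    descends to [Y]: the element [y] is the supremum in [Y] of the points below
    it that lie in some member of [S] ([supremums_trace]).  That set is nonempty
    ([trace_nonempty]), so [T] carries its supremum to a supremum in [L]. *)

Lemma meet_sup_le d (L : latticeType d) (A : set L) (s x u : L) :
  infinitely_distributive L -> supremums A s ->
  (forall a, A a -> x `&` a <= u) -> x `&` s <= u.
Proof.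
move=> hL As Au; have [_] := hL.1 A s As x.
by apply=> _ [a Aa <-]; exact: Au.
Qed.

Lemma dm_set_down d (Y : porderType d) (x : DM Y) (a b : Y) : a <= b -> dm_set x b -> dm_set x a.
Proof.
by move=> ab xb; rewrite dm_eq => w xw; exact: le_trans ab (xw _ xb).
Qed.

Section Extension.
Variables (dY dL : Order.disp_t) (Y : porderType dY) (L : latticeType dL).
Variable hL : complete_lattice L.

Lemma dm_ext_ub (T : Y -> L) (x : DM Y) (y : Y) :
  dm_set x y -> T y <= dm_ext hL T x.
Proof.
move=> xy; have [ub _] := csupP hL [set T y | y in [set y | dm_embed y <= x]].
by apply: ub; exists y => //; apply/dm_embed_le.
Qed.

Lemma dm_ext_le (T : Y -> L) (x : DM Y) (u : L) :
  (forall y, dm_set x y -> T y <= u) -> dm_ext hL T x <= u.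
Proof.
move=> xu; have [_] := csupP hL [set T y | y in [set y | dm_embed y <= x]].
by apply=> _ [y /dm_embed_le xy <-]; exact: xu.
Qed.

Lemma dm_ext_mono (T : Y -> L) (x z : DM Y) :
  x <= z -> dm_ext hL T x <= dm_ext hL T z.
Proof.
rewrite dm_leE => /asboolP xz.
by apply: dm_ext_le => y /xz; exact: dm_ext_ub.
Qed.

End Extension.

Lemma dm_ext_embed dY dL (Y : latticeType dY) (L : latticeType dL)
    (hL : complete_lattice L) (T : {lmorphism Y -> L}) (y : Y) :
  dm_ext hL T (dm_embed y) = T y.
Proof.
apply/le_anti/andP; split; last by apply: dm_ext_ub => /=.
by apply: dm_ext_le => z /= zy; exact: omorph_le.
Qed.

Lemma dm_ext_meet dY dL (Y : latticeType dY) (L : latticeType dL)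
    (hL : complete_lattice L) (T : {lmorphism Y -> L}) :
  infinitely_distributive L -> Order.meet_morphism (dm_ext hL T).
Proof.
move=> hLd x z; apply/le_anti/andP; split.
  by rewrite lexI !dm_ext_mono// ?leIl// leIr.
apply: (meet_sup_le hLd (csupP hL _)) => _ [b /dm_embed_le zb <-].
rewrite meetC.
apply: (meet_sup_le hLd (csupP hL _)) => _ [a /dm_embed_le xa <-].
rewrite -omorphI; apply: dm_ext_ub; split.
  exact: dm_set_down (leIr _ _) xa.
exact: dm_set_down (leIl _ _) zb.
Qed.

Definition trace d (Y : porderType d) (S : set (DM Y)) (y : Y) : set Y :=
  [set a | a <= y /\ exists2 c, S c & dm_set c a].

(** Distributivity of the completion, read inside [Y]: an upper bound
    [w] of the trace makes [dm_embed w] an upper bound of all the cuts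
    [dm_embed y `&` c], hence of their join, which is [dm_embed y]. *)
Lemma supremums_trace d (Y : latticeType d) (S : set (DM Y)) (s : DM Y) (y : Y) :
  infinitely_distributive (DM Y) -> supremums S s -> dm_set s y ->
  supremums (trace S y) y.
Proof.
move=> hY Ss sy; split=> [a [] //|w tw].
have /asboolP : dm_embed y <= dm_embed w.
  have /meet_idPl <- : dm_embed y <= s by apply/dm_embed_le.
  apply: meet_sup_le hY Ss _ => c Sc; rewrite dm_leE; apply/asboolP => a /= [ay ca].
  by apply: tw; split=> //; exists c.
by apply=> /=.
Qed.

(** An element that is the supremum of the empty set is the least element of
    [Y], and so belongs to every cut; in particular it would lie in the trace. *)
Lemma trace_nonempty d (Y : porderType d) (S : set (DM Y)) (y : Y) :
  S !=set0 -> supremums (trace S y) y -> trace S y !=set0.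
Proof.
move=> [c Sc] [_ ylub]; apply: contrapT => t0.
apply: (t0); exists y; split=> //; exists c => //.
by rewrite dm_eq => w _; apply: ylub => a ta; case: t0; exists a.
Qed.

Lemma dm_ext_joins dY dL (Y : latticeType dY) (L : latticeType dL)
    (hL : complete_lattice L) (T : Y -> L) :
  infinitely_distributive (DM Y) ->
  preserves_existing_joins T -> preserves_existing_joins (dm_ext hL T).
Proof.
move=> hY hT S s S0 Ss; split=> [_ [c Sc <-]|u Su].
  by apply: dm_ext_mono; exact: Ss.1.
apply: dm_ext_le => y sy.
have ysup := supremums_trace hY Ss sy.
have [_] := hT _ _ (trace_nonempty S0 ysup) ysup.
apply=> _ [a [_ [c Sc ca]] <-].
by apply: le_trans (dm_ext_ub hL T ca) _; apply: Su; exists c.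
Qed.

Theorem theorem3p14 (dY dL : Order.disp_t)
    (Y : latticeType dY) (L : latticeType dL)
    (hY : infinitely_distributive (DM Y))
    (hL : complete_lattice L) (hLd : infinitely_distributive L)
    (T : {lmorphism Y -> L}) :
  (Order.meet_morphism (dm_ext hL T) /\
   (forall y : Y, dm_ext hL T (dm_embed y) = T y)) /\
  (preserves_existing_joins T -> preserves_existing_joins (dm_ext hL T)).
Proof.
split; last exact: dm_ext_joins.
by split=> [|y]; [exact: dm_ext_meet|exact: dm_ext_embed].
Qed.
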